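(* Let $k$ be a positive integer and let $H$ be a triangle-free graph. Let $I_k \vee H$ denote the graph obtained from the disjoint union of an independent set $I_k$ of $k$ vertices and $H$ by adding all edges between $I_k$ and $V(H)$. Then \[ \nu(I_k \vee H) = \alpha'_k(H) \quad\text{and}\quad \tau(I_k \vee H) = k|V(H)| - \phi_k(H). \]
   Context: Graphs are finite and simple. For a graph $G$, $\tau(G)$ is the minimum size of an edge set $Y$ such that $G - Y$ is triangle-free, and $\nu(G)$ is the maximum size of a set of pairwise edge-disjoint triangles in $G$. $\alpha'_k(H)$ is the largest number of edges in a $k$-edge-colorable subgraph of $H$. A vertex set $D$ is $k$-dependent if $H[D]$ has maximum degree at most $k-1$; for $D \subseteq V(H)$, $\phi_k(D) = k|D| - |E(H[D])|$; and $\phi_k(H)$ denotes the maximum of $\phi_k(D)$ over all $k$-dependent sets $D \subseteq V(H)$. *)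

(* Defs.v *)
From HB Require Import structures.
From mathcomp Require Import all_boot all_order all_algebra.

Set Implicit Arguments.
Unset Strict Implicit.
Unset Printing Implicit Defensive.

Import Order.TTheory GRing.Theory Num.Theory.

Record sgraph := SGraph {
  vertex :> finType;
  adj : rel vertex;
  adj_sym : symmetric adj;
  adj_irr : irreflexive adj }.

Arguments adj {s} _ _.

(* Edges are two-element vertex sets. *)
Definition edges (G : sgraph) : {set {set G}} :=
  [set f : {set G} | [exists x, exists y, adj x y && (f == [set x; y])]].

Section Constructions.

Variable G : sgraph.

Definition spanning_rel (F : {set {set G}}) : rel G :=
  fun x y => adj x y && ([set x; y] \in F).

Lemma spanning_sym F : symmetric (spanning_rel F).
Proof. by move=> x y; rewrite /spanning_rel adj_sym setUC. Qed.

Lemma spanning_irr F : irreflexive (spanning_rel F).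
Proof. by move=> x; rewrite /spanning_rel adj_irr. Qed.

(* For F \subset edges G, the subgraph (V(G), F). *)
Definition spanning_subgraph (F : {set {set G}}) : sgraph :=
  SGraph (spanning_sym F) (spanning_irr F).

Definition del_edges (Y : {set {set G}}) : sgraph :=
  spanning_subgraph (edges G :\: Y).

Definition induced_rel (D : {set G}) : rel {x : G | x \in D} :=
  fun x y => adj (val x) (val y).

Lemma induced_sym D : symmetric (@induced_rel D).
Proof. by move=> x y; rewrite /induced_rel adj_sym. Qed.

Lemma induced_irr D : irreflexive (@induced_rel D).
Proof. by move=> x; rewrite /induced_rel adj_irr. Qed.

Definition induced (D : {set G}) : sgraph :=
  SGraph (@induced_sym D) (@induced_irr D).

End Constructions.

Section Join.

Variables G H : sgraph.

Definition join_rel : rel (G + H)%type := fun u v =>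
  match u, v with
  | inl x, inl y => adj x y
  | inr x, inr y => adj x y
  | _, _ => true
  end.

Lemma join_sym : symmetric join_rel.
Proof. by move=> [x|x] [y|y] //=; rewrite adj_sym. Qed.

Lemma join_irr : irreflexive join_rel.
Proof. by move=> [x|x] /=; rewrite adj_irr. Qed.

Definition join : sgraph := SGraph join_sym join_irr.

End Join.

Lemma edgeless_sym k : symmetric (fun _ _ : 'I_k => false).
Proof. by []. Qed.

Lemma edgeless_irr k : irreflexive (fun _ _ : 'I_k => false).
Proof. by []. Qed.

Definition edgeless (k : nat) : sgraph :=
  SGraph (@edgeless_sym k) (@edgeless_irr k).

Section Invariants.

Variable G : sgraph.

(* Triangles are represented by their vertex sets. *)
Definition is_triangle (S : {set G}) : bool :=
  (#|S| == 3) && [forall x in S, forall y in S, (x != y) ==> adj x y].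

Definition triangle_free : bool := [forall S : {set G}, ~~ is_triangle S].

Definition triangle_edges (S : {set G}) : {set {set G}} :=
  [set f in edges G | f \subset S].

Definition triangle_packing (P : {set {set G}}) : bool :=
  [forall S in P, is_triangle S] &&
  [forall S in P, forall T in P,
     (S != T) ==> [disjoint triangle_edges S & triangle_edges T]].

Definition nu : nat := \max_(P : {set {set G}} | triangle_packing P) #|P|.

Definition edge_colorable (k : nat) : bool :=
  [exists c : {ffun {set G} -> 'I_k},
     [forall f in edges G, forall g in edges G,
        (f != g) && (f :&: g != set0) ==> (c f != c g)]].

Definition degree (x : G) : nat := #|[set y | adj x y]|.

Definition max_degree : nat := \max_(x : G) degree x.

End Invariants.

Section Extrema.

Variable G : sgraph.

Definition triangle_cover (Y : {set {set G}}) : bool :=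
  (Y \subset edges G) && triangle_free (del_edges Y).

(* The default value of the arg min in tau is itself a candidate. *)
Lemma triangle_cover_edges : triangle_cover (edges G).
Proof.
rewrite /triangle_cover subxx; apply/forallP => S; apply/negP.
case/andP=> S3 /forall_inP clS.
have /card_gt1P[x [y [xS yS xy]]] : 1 < #|S| by rewrite (eqP S3).
have := clS x xS => /forall_inP/(_ y yS)/implyP/(_ xy).
by rewrite /= /spanning_rel setDv inE andbF.
Qed.

Definition tau : nat :=
  #|[arg min_(Y < edges G | triangle_cover Y) #|Y|]|.

Definition alpha' (k : nat) : nat :=
  \max_(F : {set {set G}} |
     (F \subset edges G) && edge_colorable (spanning_subgraph F) k) #|F|.

Definition dependent (k : nat) (D : {set G}) : bool :=
  max_degree (induced D) <= k.-1.

Definition phi_set (k : nat) (D : {set G}) : int :=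
  ((k * #|D|)%:Z - #|edges (induced D)|%:Z)%R.

(* The default value of the arg max in phi is itself a candidate. *)
Lemma dependent0 k : dependent k set0.
Proof. by apply/bigmax_leqP => -[x hx]; have := hx; rewrite inE. Qed.

Definition phi (k : nat) : int :=
  phi_set k [arg max_(D > set0 | dependent k D) phi_set k D]%O.

End Extrema.

(* Main.v *)
(* The triangles of the join are the cones over edges e of H with apex i in
   I_k. Cones over the same edge always share it, and two cones with the same
   apex share an edge exactly when their bases meet, so edge-disjoint triangles
   are a partial proper edge colouring of H with the apex as colour.

   For a k-dependent D, the edges of H[D] together with the edges from I_k to
   the complement of D form a triangle cover of size k|V(H)| - phi_k(D).
   Conversely, a cover Y yields, at an apex meeting the fewest edges of Y, a
   set D with k|V(H)| - phi_k(D) <= |Y|; D need not be k-dependent, but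
   deleting vertices of degree at least k in H[D] does not decrease phi_k. *)
Require Import Defs.
From mathcomp Require Import all_boot all_order all_algebra.
From mathcomp Require Import zify.

Set Implicit Arguments.
Unset Strict Implicit.
Unset Printing Implicit Defensive.

(** * Edges as pairs and triangles as triples of adjacent vertices *)

Section Graphs.

Variable G : sgraph.
Implicit Types (x y z : G) (f S : {set G}).

Lemma edgesP (f : {set G}) :
  reflect (exists x y, adj x y /\ f = [set x; y]) (f \in edges G).
Proof.
rewrite inE; apply: (iffP existsP) => [[x /existsP[y /andP[xy /eqP->]]]|].
  by exists x, y.
by move=> [x [y [xy ->]]]; exists x; apply/existsP; exists y; rewrite xy eqxx.
Qed.

Lemma adj_neq x y : adj x y -> x != y.
Proof. by apply: contraTneq => ->; rewrite adj_irr. Qed.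

Lemma pair_in_edges x y : ([set x; y] \in edges G) = adj x y.
Proof.
apply/edgesP/idP => [[a [b [ab E]]]|xy]; last by exists x, y.
have := adj_neq ab.
have: (a \in [set x; y]) /\ (b \in [set x; y]) by rewrite E !inE !eqxx orbT.
rewrite !inE => -[/orP[]/eqP xa /orP[]/eqP yb]; rewrite xa yb ?eqxx //.
  by move: ab; rewrite xa yb.
by move: ab; rewrite xa yb adj_sym.
Qed.

Lemma card_edge f : f \in edges G -> #|f| = 2.
Proof. by move=> /edgesP[x [y [/adj_neq xy ->]]]; rewrite cards2 xy. Qed.

(** Naming the three vertices makes it possible, in the join, to split on which of them lie in
    [edgeless k]. *)
Lemma is_triangleP S :
  reflect (exists x y z, [/\ adj x y, adj x z, adj y z & S = [set x; y; z]])
          (is_triangle S).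
Proof.
have card3 x y z : x != y -> x != z -> y != z -> #|[set x; y; z]| = 3.
  by move=> xy xz yz; rewrite setUC cardsU1 cards2 !inE negb_or ![z == _]eq_sym xy xz yz.
apply: (iffP andP) => [[/eqP S3 /forall_inP adjS]|].
  have /card_gt2P[x [y [z [[xS yS zS] [xy yz zx]]]]] : 2 < #|S| by rewrite S3.
  have xz : x != z by rewrite eq_sym.
  have adjP u v : u \in S -> v \in S -> u != v -> adj u v.
    by move=> uS vS; apply/implyP; have /forall_inP := adjS u uS; apply.
  exists x, y, z; split; try exact: adjP.
  by apply/esym/eqP; rewrite eqEcard !subUset !sub1set xS yS zS S3 card3.
move=> [x [y [z [xy xz yz ->]]]]; split; first by rewrite card3 ?adj_neq.
apply/forall_inP => u uS; apply/forall_inP => v vS; apply/implyP.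
move: uS vS; rewrite !inE -!orbA.
by move=> /or3P[]/eqP-> /or3P[]/eqP->; rewrite ?eqxx // => _; rewrite // adj_sym.
Qed.

End Graphs.

(** * Edge deletion, and edge counts of induced subgraphs *)

Section Subgraphs.

Variable G : sgraph.
Implicit Types (x y z : G) (f S D : {set G}) (Y F : {set {set G}}).

Lemma edges_spanning_subgraph F :
  F \subset edges G -> edges (spanning_subgraph F) = F.
Proof.
move=> sFE; apply/setP => f; rewrite inE; apply/idP/idP.
  by move=> /existsP[x /existsP[y /andP[/andP[_ xyF] /eqP->]]].
move=> fF; have /edgesP[x [y [xy fE]]] := subsetP sFE f fF.
apply/existsP; exists x; apply/existsP; exists y.
by rewrite /= /spanning_rel xy -fE fF /=.
Qed.

Lemma triangle_free_del_edgesP Y :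
  reflect (forall x y z, adj x y -> adj x z -> adj y z ->
             [|| [set x; y] \in Y, [set x; z] \in Y | [set y; z] \in Y])
          (triangle_free (del_edges Y)).
Proof.
have delE x y : @adj (del_edges Y) x y = adj x y && ([set x; y] \notin Y).
  rewrite /= /spanning_rel in_setD pair_in_edges.
  by case: (adj x y); rewrite ?andbF ?andbT.
apply: (iffP forallP) => [noT x y z xy xz yz|covY S].
  apply: contraNT (noT ([set x; y; z] : {set del_edges Y})).
  move=> /norP[xyY /norP[xzY yzY]].
  apply/is_triangleP; exists x, y, z.
  by rewrite !delE xy xz yz.
apply/negP => /is_triangleP[x [y [z []]]]; rewrite !delE.
move=> /andP[xy /negPf xyY] /andP[xz /negPf xzY] /andP[yz /negPf yzY] _.
by have := covY x y z xy xz yz; rewrite xyY xzY yzY.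
Qed.

Lemma mem_triangle_edges S f :
  (f \in triangle_edges S) = (f \in edges G) && (f \subset S).
Proof. by rewrite /triangle_edges in_set. Qed.

(** The image under [val] is a bijection between the two sets. [triangle_edges], applied to an
    arbitrary vertex set, thus stands for the edge set of the induced subgraph without its
    subtype. *)
Lemma card_edges_induced D : #|edges (induced D)| = #|triangle_edges D|.
Proof.
have inj : injective (fun f : {set induced D} => val @: f).
  exact: imset_inj val_inj.
rewrite -(card_imset _ inj); apply: eq_card => f; apply/imsetP/idP.
  move=> [g /edgesP[x [y [xy ->]]] ->].
  rewrite imsetU1 imset_set1 mem_triangle_edges pair_in_edges [adj _ _]xy.
  by apply/subsetP => u; rewrite !inE => /orP[]/eqP->; apply: valP.
rewrite mem_triangle_edges => /andP[/edgesP[x [y [xy ->]]] /subsetP sD].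
have xD : x \in D by apply: sD; rewrite !inE eqxx.
have yD : y \in D by apply: sD; rewrite !inE eqxx orbT.
exists [set (Sub x xD : induced D); Sub y yD].
  by rewrite pair_in_edges.
by rewrite imsetU1 imset_set1.
Qed.

Lemma degree_induced D (x : induced D) :
  degree x = #|[set y in D | adj (val x) y]|.
Proof.
rewrite /degree -(card_imset _ val_inj); apply: eq_card => y.
apply/imsetP/idP => [[z]|]; rewrite inE.
  by rewrite inE => xz ->; rewrite (valP z).
by move=> /andP[yD xy]; exists (Sub y yD); rewrite ?inE.
Qed.

(** The edges lost with [x] are the pairs [[set x; y]] with [y] a neighbour of [x] in [D], and [y]
    is recovered from the pair. *)
Lemma card_triangle_edges_D1 D x : x \in D ->
  #|triangle_edges D| = #|triangle_edges (D :\ x)| + #|[set y in D | adj x y]|.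
Proof.
move=> xD; rewrite -(cardsID (triangle_edges (D :\ x)) (triangle_edges D)); congr (_ + _).
  congr #|pred_of_set _|; apply/setIidPr/subsetP => f.
  rewrite !mem_triangle_edges => /andP[-> /subset_trans]; apply.
  exact: subD1set.
have inj : {in [set y in D | adj x y] &, injective (fun y => [set x; y])}.
  move=> y z; rewrite !inE => /andP[_ /adj_neq xy] _ E.
  have : y \in [set x; z] by rewrite -E !inE eqxx orbT.
  by rewrite !inE eq_sym (negPf xy) => /eqP.
rewrite -(card_in_imset inj); apply: eq_card => f; apply/idP/imsetP.
  rewrite in_setD !mem_triangle_edges subsetD1.
  move=> /andP[+ /andP[fE fD]]; rewrite fE fD /= negbK => xf.
  have /edgesP[a [b [ab fab]]] := fE.
  move: xf fD; rewrite fab !inE => /orP[]/eqP-> /subsetP sD.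
    by exists b => //; rewrite inE ab sD ?inE ?eqxx ?orbT.
  by exists a; rewrite 1?setUC // inE adj_sym ab sD ?inE ?eqxx ?orbT.
move=> [y]; rewrite inE => /andP[yD xy] ->.
rewrite in_setD !mem_triangle_edges pair_in_edges xy subsetD1 !inE eqxx /=.
rewrite andbF /=.
by apply/subsetP => u; rewrite !inE => /orP[]/eqP->.
Qed.

(** * Extremal properties of [phi] and [tau] *)

Lemma dependent_phi_set_ge k D :
  exists2 D' : {set G}, dependent k D' & (phi_set k D <= phi_set k D')%R.
Proof.
have [n] := ubnP #|D|; elim: n D => // n IHn D ltDn.
have [/existsP[x degx]|/existsPn ltdeg] :=
    boolP [exists x : induced D, k.-1 < degree x]; last first.
  by exists D => //; apply/bigmax_leqP => x _; rewrite leqNgt.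
have xD := valP x; rewrite degree_induced in degx.
have cD := cardsD1 (val x) D; rewrite xD in cD.
have cE := card_triangle_edges_D1 xD.
have [|D' depD' le] := IHn (D :\ val x); first by lia.
exists D' => //; apply: Order.POrderTheory.le_trans le.
rewrite /phi_set !card_edges_induced cE cD.
(* [k * #|D|] drops by [k] and the edge count by the degree of [x], which is at least [k], also for
   [k = 0] where [k.-1] truncates. *)
nia.
Qed.

(** Since [D] ranges over all vertex sets, this applies directly to the set that a cover of the join
    yields. *)
Lemma phi_ge k D : (phi_set k D <= phi G k)%R.
Proof.
have [D' depD' /Order.POrderTheory.le_trans-> //] := dependent_phi_set_ge k D.
rewrite /phi; case: Order.TotalTheory.arg_maxP => [|D0 _]; first exact: dependent0.
exact.
Qed.

Lemma phi_attained k : exists D, phi G k = phi_set k D.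
Proof. by eexists. Qed.

Lemma tau_le Y : triangle_cover Y -> tau G <= #|Y|.
Proof.
rewrite /tau; case: arg_minnP => [|Y0 _]; first exact: triangle_cover_edges.
exact.
Qed.

Lemma tau_attained : exists2 Y : {set {set G}}, triangle_cover Y & tau G = #|Y|.
Proof.
rewrite /tau; case: arg_minnP => [|Y0 Y0c _]; first exact: triangle_cover_edges.
by exists Y0.
Qed.

End Subgraphs.

(** * Edges and triangles of the join: spokes, bases and cones *)

Section Join.

Variables (k : nat) (H : sgraph).

Local Notation J := (join (edgeless k) H).
Implicit Types (i j : 'I_k) (u v : H) (e f : {set H}).

Definition spoke i v : {set J} := [set inl i; inr v].

Definition base e : {set J} := inr @: e.

Definition cone i e : {set J} := inl i |: base e.

Lemma inl_in_base i e : (inl i \in base e) = false.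
Proof. by apply/imsetP => -[]. Qed.

Lemma inr_in_base v e : (inr v \in base e) = (v \in e).
Proof. by rewrite mem_imset //; apply: inr_inj. Qed.

Lemma inl_in_cone i j e : (inl i \in cone j e) = (i == j).
Proof. by rewrite in_setU1 inl_in_base orbF. Qed.

Lemma inr_in_cone v j e : (inr v \in cone j e) = (v \in e).
Proof. by rewrite in_setU1 inr_in_base. Qed.

Lemma base_inj : injective base.
Proof. by apply: imset_inj => x y []. Qed.

Lemma base_pair u v : base [set u; v] = [set inr u; inr v].
Proof. by rewrite /base imsetU1 imset_set1. Qed.

Lemma cone_inj i j e f : cone i e = cone j f -> e = f.
Proof. by move=> E; apply/setP => v; rewrite -(inr_in_cone v i) E inr_in_cone. Qed.

Lemma spoke_inj : injective (fun p : 'I_k * H => spoke p.1 p.2).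
Proof.
move=> [i u] [j v] /= E.
have : inl i \in spoke j v by rewrite -E !inE eqxx.
have : inr u \in spoke j v by rewrite -E !inE eqxx orbT.
by rewrite !inE /= orbF => /eqP[->] /eqP[->].
Qed.

Lemma base_neq_spoke e i v : base e != spoke i v.
Proof.
apply/eqP => /setP/(_ (inl i)).
by rewrite inl_in_base !inE eqxx.
Qed.

Lemma base_in_edges e : (base e \in edges J) = (e \in edges H).
Proof.
apply/idP/edgesP => [/edgesP[[i|u] [[j|v] []]] //= uv E|[u [v [uv ->]]]].
- by have := inl_in_base i e; rewrite E !inE eqxx.
- by have := inl_in_base j e; rewrite E !inE eqxx.
- by exists u, v; split=> //; apply: base_inj; rewrite base_pair.
- by rewrite base_pair pair_in_edges.
Qed.

Lemma spoke_in_edges i v : spoke i v \in edges J.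
Proof. by rewrite pair_in_edges. Qed.

Lemma join_edge_cases (f : {set J}) : f \in edges J ->
  (exists2 e, e \in edges H & f = base e) \/ exists i v, f = spoke i v.
Proof.
move=> /edgesP[[i|u] [[j|v] []]] //= uv ->.
- by right; exists i, v.
- by right; exists j, u; rewrite setUC.
- by left; exists [set u; v]; rewrite ?pair_in_edges ?base_pair.
Qed.

Lemma base_sub_cone e i f : (base e \subset cone i f) = (e \subset f).
Proof.
apply/subsetP/subsetP => sef x => [xe|/imsetP[v /sef vf ->]].
  by rewrite -(inr_in_cone x i) sef ?inr_in_base.
by rewrite inr_in_cone.
Qed.

Lemma spoke_sub_cone j v i f :
  (spoke j v \subset cone i f) = (j == i) && (v \in f).
Proof. by rewrite subUset !sub1set inl_in_cone inr_in_cone. Qed.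

Lemma cone_triangle i e : e \in edges H -> is_triangle (cone i e).
Proof.
move=> /edgesP[u [v [uv ->]]]; apply/is_triangleP.
exists (inl i), (inr u), (inr v); split=> //.
by rewrite /cone base_pair setUA.
Qed.

(* I_k is independent and H is triangle-free, so a triangle has exactly one
   vertex in I_k. *)
Lemma triangle_cone (S : {set J}) : triangle_free H ->
  is_triangle S -> exists i e, e \in edges H /\ S = cone i e.
Proof.
move=> hH; have mk i u v : adj u v -> S = [set inl i; inr u; inr v] ->
    exists i e, e \in edges H /\ S = cone i e.
  move=> uv ->; exists i, [set u; v]; rewrite pair_in_edges.
  by rewrite /cone base_pair setUA.
move=> /is_triangleP[[x|x] [[y|y] [[z|z] []]]] //= xy xz yz E.
- exact: mk yz E.
- by apply: (mk y x z xz); rewrite E (setUC [set inr x]).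
- by apply: (mk z x y xy); rewrite E setUC setUA.
have /forallP/(_ [set x; y; z])/negP[] := hH.
by apply/is_triangleP; exists x, y, z.
Qed.

(** A common edge of two cones is either a base, which forces [e = f], or a spoke, which forces
    equal apexes and a common vertex of [e] and [f]. Conversely, [base e] and [spoke i v] witness
    these two overlaps. *)
Lemma disjoint_cone_edges i j e f : e \in edges H -> f \in edges H ->
  [disjoint triangle_edges (cone i e) & triangle_edges (cone j f)] =
  (e != f) && ((i == j) ==> (e :&: f == set0)).
Proof.
move=> eE fE; apply/idP/idP.
  move=> dis.
  have noedge g : g \in edges J ->
      g \subset cone i e -> g \subset cone j f -> False.
    move=> gE ge gf; have := disjointFr dis (x := g).
    by rewrite !mem_triangle_edges gE ge gf => /(_ isT).
  apply/andP; split.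
    apply/eqP => ef; apply: (noedge (base e)).
    - by rewrite base_in_edges.
    - by rewrite base_sub_cone.
    - by rewrite base_sub_cone ef.
  apply/implyP => /eqP ij; apply: contraT => /set0Pn[v].
  rewrite inE => /andP[ve vf]; case: (noedge (spoke i v)).
  - exact: spoke_in_edges.
  - by rewrite spoke_sub_cone eqxx ve.
  - by rewrite spoke_sub_cone ij eqxx vf.
move=> /andP[nef /implyP ij]; apply: contraT; rewrite -setI_eq0.
move=> /set0Pn[g]; rewrite in_setI !mem_triangle_edges.
move=> /andP[/andP[gE ge] /andP[_ gf]].
have [[g' g'E Eg]|[l [v Eg]]] := join_edge_cases gE.
  move: ge gf nef; rewrite Eg !base_sub_cone => g'e g'f.
  (* Edges all have two vertices, so inclusion between them is equality. *)
  have full h : h \in edges H -> g' \subset h -> g' = h.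
    by move=> hE sg'h; apply/eqP; rewrite eqEcard sg'h !card_edge.
  by rewrite -(full e) // -(full f) // eqxx.
move: ge gf; rewrite Eg !spoke_sub_cone => /andP[/eqP li ve] /andP[/eqP lj vf].
have /ij/eqP/setP/(_ v) : i == j by rewrite -li lj.
by rewrite !inE ve vf.
Qed.

(** * Triangle packings and edge colourings *)

(** Coning each coloured edge from its colour gives a packing: distinct edges with the same colour
    do not meet. *)
Lemma nu_join_ge : alpha' H k <= nu J.
Proof.
apply/bigmax_leqP => F /andP[sFE /existsP[c /forall_inP colc]].
rewrite edges_spanning_subgraph // in colc.
have edgeF e : e \in F -> e \in edges H by apply: subsetP.
have inj : injective (fun e => cone (c e) e) by move=> e f /cone_inj.
rewrite -(card_imset _ inj).
apply: (@leq_bigmax_cond _ _ (fun P : {set {set J}} => #|P|)).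
apply/andP; split.
  by apply/forall_inP => _ /imsetP[e eF ->]; apply/cone_triangle/edgeF.
apply/forall_inP => _ /imsetP[e eF ->]; apply/forall_inP => _ /imsetP[f fF ->].
apply/implyP => nef; rewrite disjoint_cone_edges ?edgeF //.
have ef : e != f by apply: contraNneq nef => ->.
rewrite ef /=; apply/implyP => cef; apply: contraT => ef0.
have /forall_inP/(_ f fF)/implyP := colc e eF.
by rewrite ef ef0 cef => /(_ isT).
Qed.

Lemma nu_join_le : triangle_free H -> 0 < k -> nu J <= alpha' H k.
Proof.
move=> hH k0; apply/bigmax_leqP => P /andP[/forall_inP triP /forall_inP disP].
pose F := [set e in edges H | [exists i, cone i e \in P]].
(* An edge is coloured by the apex of a cone of [P] over it. The default colour, available since [k]
   is positive, is taken only outside [F]. *)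
pose c := [ffun e => odflt (Ordinal k0) [pick i | cone i e \in P]].
have cP e : e \in F -> cone (c e) e \in P.
  rewrite /F in_set ffunE => /andP[_ /existsP[i iP]].
  by case: pickP => //= /(_ i); rewrite iP.
have sFE : F \subset edges H.
  by apply/subsetP => e; rewrite /F in_set => /andP[].
have edgeF e : e \in F -> e \in edges H by apply: subsetP.
(* Cones of [P] that share an edge coincide. The case of equal bases bounds [#|P|] by [#|F|]; the
   case of equal apexes and meeting bases makes [c] proper. *)
have uniqP i j e f : e \in F -> f \in F -> cone i e \in P -> cone j f \in P ->
    e = f \/ i = j /\ e :&: f != set0 -> cone i e = cone j f.
  move=> eF fF eP fP ef; apply/eqP; apply: contraT => nef.
  have /forall_inP/(_ _ fP)/implyP/(_ nef) := disP _ eP.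
  rewrite disjoint_cone_edges ?edgeF //.
  by case: ef => [->|[-> /negPf->]]; rewrite eqxx //= andbF.
have sub : P \subset [set cone (c e) e | e in F].
  apply/subsetP => S SP; have [i [e [eE Se]]] := triangle_cone hH (triP S SP).
  have eF : e \in F.
    by rewrite /F in_set eE; apply/existsP; exists i; rewrite -Se.
  apply/imsetP; exists e => //; rewrite Se; apply: uniqP => //; last by left.
    by rewrite -Se.
  exact: cP.
apply: leq_trans (subset_leq_card sub) (leq_trans (leq_imset_card _ _) _).
apply: (@leq_bigmax_cond _ _ (fun F : {set {set H}} => #|F|)).
rewrite sFE; apply/existsP; exists c; rewrite edges_spanning_subgraph //.
apply/forall_inP => e eF; apply/forall_inP => f fF.
apply/implyP => /andP[nef ef0]; apply: contraNneq nef => cef.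
by apply/eqP/(@cone_inj (c e) (c f))/uniqP; rewrite ?cP //; right.
Qed.

(** * Triangle covers of the join *)

(** A cone over [[set u; v]] is hit at its base if [u] and [v] both lie in [D], and at a spoke
    otherwise. *)
Lemma triangle_cover_join (D : {set H}) : triangle_free H ->
  triangle_cover ([set base e | e in triangle_edges D] :|:
    [set spoke p.1 p.2 | p in setX [set: 'I_k] (~: D)]).
Proof.
move=> hH; set Y := _ :|: _.
have spY i v : v \notin D -> spoke i v \in Y.
  move=> vD; apply/setUP; right; apply/imsetP; exists (i, v) => //.
  by rewrite !inE.
have cov i u v : adj u v ->
    [|| spoke i u \in Y, spoke i v \in Y | base [set u; v] \in Y].
  move=> uv; have [uD|/spY->//] := boolP (u \in D).
  have [vD|/spY->] := boolP (v \in D); last by rewrite orbT.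
  apply/or3P/Or33/setUP; left; apply: imset_f.
  by rewrite mem_triangle_edges pair_in_edges uv subUset !sub1set uD.
apply/andP; split.
  rewrite subUset; apply/andP; split; apply/subsetP => ? /imsetP[].
    by move=> e /[!mem_triangle_edges] /andP[eE _] ->; rewrite base_in_edges.
  by move=> [i v] _ ->; apply: spoke_in_edges.
(* Two vertices in [edgeless k] are never adjacent. Three cases remain with the apex at [x], [y] or
   [z], and one with no apex, excluded by [hH]. *)
apply/triangle_free_del_edgesP => [[x|x] [y|y] [z|z]] //= xy xz yz.
- by have := cov x y z yz; rewrite base_pair.
- have := cov y x z xz; rewrite base_pair /spoke [[set inr x; inl y]]setUC.
  by rewrite [X in _ -> _ || X]orbC.
- have := cov z x y xy; rewrite base_pair /spoke ![[set inr _; inl z]]setUC.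
  by rewrite orbA orbC.
have /forallP/(_ [set x; y; z])/negP[] := hH.
by apply/is_triangleP; exists x, y, z.
Qed.

Lemma tau_join_le (D : {set H}) : triangle_free H ->
  ((tau J)%:Z <= (k * #|H|)%:Z - phi_set k D)%R.
Proof.
move=> /(triangle_cover_join D)/tau_le le1; have := leq_trans le1 (leq_card_setU _ _).
rewrite (card_imset _ base_inj) (card_imset _ spoke_inj) cardsX cardsT card_ord.
rewrite /phi_set card_edges_induced; rewrite -(cardsC D) mulnDr.
move: #|triangle_edges D| => m; lia.
Qed.

(* Given a cover Y, let D_i be the set of v with iv not in Y: no edge of
   H[D_i] is missing from Y. Take i for which D_i is largest. *)
Lemma tau_join_ge : 0 < k ->
  exists D : {set H}, ((k * #|H|)%:Z - phi_set k D <= (tau J)%:Z)%R.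
Proof.
move=> k0; have [Y /andP[_ /triangle_free_del_edgesP covY] ->] := tau_attained J.
(* [W i] is the complement of D_i, so the largest D_i comes from the smallest [W i]. *)
pose W i := [set v | spoke i v \in Y].
pose i0 := [arg min_(i < Ordinal k0) #|W i|].
have min_i0 i : #|W i0| <= #|W i|.
  by rewrite /i0; case: arg_minnP => // j _; apply.
pose D := ~: W i0; exists D.
(* [B] collects all spokes in [Y]. The bases in [A] also lie in [Y], because the cone from [i0] over
   an edge inside [D] has neither of its spokes in [Y]. *)
pose B := [set spoke p.1 p.2 | p in [set p : 'I_k * H | spoke p.1 p.2 \in Y]].
pose A := [set base e | e in triangle_edges D].
have sAB : A :|: B \subset Y.
  rewrite subUset; apply/andP; split; apply/subsetP => ? /imsetP[].
    move=> e /[!mem_triangle_edges] /andP[/edgesP[u [v [uv ->]]]].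
    rewrite subUset !sub1set !inE => /andP[/negPf uY /negPf vY] ->.
    have := covY (inl i0) (inr u) (inr v) isT isT uv.
    by rewrite -/(spoke i0 u) -/(spoke i0 v) uY vY base_pair.
  by move=> p; rewrite inE => pY ->.
have dAB : [disjoint A & B].
  apply/pred0P => f; apply/negP => /andP[/imsetP[e _ ->] /imsetP[p _]] /eqP.
  by rewrite (negPf (base_neq_spoke _ _ _)).
have := subset_leq_card sAB.
move: (dAB); rewrite -leq_card_setU => /eqP->.
rewrite (card_imset _ base_inj) (card_imset _ spoke_inj).
(* The spokes in [Y] are counted apex by apex; by minimality of [W i0] there are at least
   [k * #|W i0|] of them. *)
have -> : #|[set p : 'I_k * H | spoke p.1 p.2 \in Y]| = \sum_i #|W i|.
  rewrite -sum1_card (eq_bigl (fun p : 'I_k * H => true && (p.2 \in W p.1))).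
    rewrite -(pair_big_dep predT (fun i v => v \in W i) (fun _ _ => 1)) /=.
    by apply: eq_bigr => i _; rewrite sum1_card.
  by move=> p; rewrite !inE.
have : k * #|W i0| <= \sum_i #|W i|.
  rewrite -[X in X * _]card_ord -sum_nat_const.
  by apply: leq_sum => i _; apply: min_i0.
rewrite /phi_set card_edges_induced; rewrite -(cardsC (W i0)) -/D mulnDr.
move: #|triangle_edges D| #|Y| (\sum_i _) => m p s; lia.
Qed.

End Join.

Theorem theorem1p7 (k : nat) (H : sgraph) (hk : 0 < k) (hH : triangle_free H) :
  nu (join (edgeless k) H) = alpha' H k /\
  ((tau (join (edgeless k) H))%:Z = (k * #|H|)%:Z - phi H k :> int)%R.

Proof.
split.
  by apply/eqP; rewrite eqn_leq nu_join_le // nu_join_ge.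
(* The maximiser [D0] gives the upper bound on [tau]. The set [D] obtained from a minimum cover
   gives the lower bound, as [phi_set k D] is at most [phi H k]. *)
have [D0 phiE] := phi_attained H k; have := tau_join_le k D0 hH.
have [D geD] := tau_join_ge H hk; have := phi_ge k D.
lia.
Qed.
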